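(* Let $\mathcal{D}$ be the mirror Heisenberg-Virasoro algebra over $\mathbb{C}$, and for $\delta\in\mathbb{C}$ let $\mathfrak{Der}_\delta(\mathcal{D})$ be the space of $\delta$-derivations of $\mathcal{D}$. Then $$\mathfrak{Der}_{\delta}(\mathcal{D})=\begin{cases}\mathrm{Inn}(\mathcal{D})\oplus\mathbb{C}\tau & \text{if }\delta=1,\\ \mathbb{C}\,\mathrm{id}_{\mathcal{D}} & \text{if }\delta=\frac12,\\ 0 & \text{otherwise.}\end{cases}$$
   Context: All vector spaces are over $\mathbb{C}$. The mirror Heisenberg-Virasoro algebra $\mathcal{D}$ is the complex Lie algebra with basis $\{L_m,\mathbf{c}\mid m\in\mathbb{Z}\}\cup\{I_r,\mathbf{l}\mid r\in\frac12+\mathbb{Z}\}$ and non-vanishing brackets $$[L_m,L_n]=(m-n)L_{m+n}+\delta_{m+n,0}\tfrac{m^3-m}{12}\mathbf{c},\quad [L_m,I_r]=-rI_{m+r},\quad [I_r,I_s]=r\delta_{r+s,0}\mathbf{l},$$ for $m,n\in\mathbb{Z}$, $r,s\in\frac12+\mathbb{Z}$ (so $\mathbf{c},\mathbf{l}$ are central). For a Lie algebra $\mathfrak{g}$ and $\delta\in\mathbb{C}$, a $\delta$-derivation of $\mathfrak{g}$ is a linear map $f:\mathfrak{g}\to\mathfrak{g}$ with $f([x,y])=\delta[f(x),y]+\delta[x,f(y)]$ for all $x,y\in\mathfrak{g}$. $\mathrm{Inn}(\mathcal{D})$ is the space of inner derivations of $\mathcal{D}$. The linear map $\tau$ on $\mathcal{D}$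 is the derivation defined by $\tau(L_m)=\tau(\mathbf{c})=0$, $\tau(I_r)=I_r$, $\tau(\mathbf{l})=2\mathbf{l}$. *)

(* Defs.v *)
From HB Require Import structures.
From mathcomp Require Import all_boot all_order all_algebra.
From mathcomp Require Import finmap.
From mathcomp Require Import mathcomp_extra boolp classical_sets functions.
From mathcomp Require Import reals.
From mathcomp Require Import ring.
From mathcomp.real_closed Require Import complex.
From mathcomp.multinomials Require Import monalg.

Set Implicit Arguments.
Unset Strict Implicit.
Unset Printing Implicit Defensive.

Import Order.TTheory GRing.Theory Num.Theory.

Local Open Scope ring_scope.
Local Open Scope classical_set_scope.

HB.mixin Record Lmodule_isLieAlgebra (F : fieldType) L of GRing.Lmodule F L := {
  lie : L -> L -> L;
  lie_linearl : forall y, linear (lie^~ y);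
  lie_linearr : forall x, linear (lie x);
  liexx : forall x, lie x x = 0;
  lie_jacobi : forall x y z,
    lie x (lie y z) + lie y (lie z x) + lie z (lie x y) = 0
}.

#[short(type="lieAlgType")]
HB.structure Definition LieAlgebra (F : fieldType) :=
  { L of GRing.Lmodule F L & Lmodule_isLieAlgebra F L }.

Section Derivations.
Context {F : fieldType} (L : lieAlgType F).

(* Spaces of maps L -> L are subsets of the pointwise F-module L -> L. *)

Definition Der (delta : F) : set (L -> L) :=
  [set f | linear f /\
     forall x y, f (lie x y) = delta *: lie (f x) y + delta *: lie x (f y)].

Definition Inn : set (L -> L) := range (fun x : L => lie x).

End Derivations.

Arguments Der {F} L delta.
Arguments Inn {F} L.

Definition line {F : fieldType} {V : lmodType F} (v : V) : set V :=
  range (fun a : F => a *: v).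

Definition is_direct_sum {V : zmodType} (W A B : set V) : Prop :=
  W = [set a + b | a in A & b in B] /\ A `&` B = [set 0].

(* [iI j] is the index of the basis vector I_r with r = j + 1/2. *)
Inductive mhv_index : Type := iL of int | iI of int | ic | il.

Definition mhv_index_code (i : mhv_index) : (int + int) + bool :=
  match i with
  | iL m => inl (inl m) | iI j => inl (inr j)
  | ic => inr true | il => inr false
  end.

Definition mhv_index_decode (s : (int + int) + bool) : mhv_index :=
  match s with
  | inl (inl m) => iL m | inl (inr j) => iI j
  | inr true => ic | inr false => il
  end.

Lemma mhv_index_codeK : cancel mhv_index_code mhv_index_decode.
Proof. by case. Qed.

HB.instance Definition _ := Choice.copy mhv_index (can_type mhv_index_codeK).

Section LinearExtension.
Context {F : fieldType} {K : choiceType} {V : lmodType F}.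

Definition linext (u : K -> V) (x : {malg F[K]}) : V :=
  \sum_(k <- msupp x) x@_k *: u k.

Local Open Scope fset_scope.

Lemma linextEw (u : K -> V) (x : {malg F[K]}) (d : {fset K}) :
  msupp x `<=` d -> linext u x = \sum_(k <- d) x@_k *: u k.
Proof.
move=> sd; rewrite /linext (big_fset_incl _ sd) //= => k _ kx.
by rewrite mcoeff_outdom // scale0r.
Qed.

Lemma linext_linear (u : K -> V) : linear (linext u).
Proof.
move=> a x y.
pose d := msupp x `|` msupp y.
rewrite (@linextEw _ x d) ?fsubsetUl// (@linextEw _ y d) ?fsubsetUr//.
rewrite (@linextEw _ _ d).
  rewrite scaler_sumr -big_split /=; apply: eq_bigr => k _.
  by rewrite mcoeffD mcoeffZ scalerDl scalerA.
apply: (fsubset_trans (msuppD_le _ _)).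
by apply: fsetSU; apply: msuppZ_le.
Qed.

Lemma linextU (u : K -> V) (k : K) : linext u << 1 *g k >> = u k.
Proof.
rewrite (@linextEw _ _ [fset k]) ?msuppU_le //.
by rewrite big_seq_fset1 mcoeffUU scale1r.
Qed.

Lemma linear_malg0 (f : {malg F[K]} -> V) :
  linear f -> (forall k, f << 1 *g k >> = 0) -> forall x, f x = 0.
Proof.
move=> lf f0 x; pose g : {linear {malg F[K]} -> V} :=
  HB.pack_for {linear {malg F[K]} -> V} f (GRing.isLinear.Build F _ V _ f lf).
rewrite (monalgE x) -[f]/(g : _ -> _) linear_sum /=; apply: big1 => k _.
have -> : << x@_k *g k >> = x@_k *: << 1 *g k >> :> {malg F[K]}.
  by apply/malgP => k'; rewrite mcoeffZ !mcoeffU; case: eqP; rewrite ?mulr1 ?mulr0.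
by rewrite -[f]/(g : _ -> _) linearZ /= f0 scaler0.
Qed.

End LinearExtension.

Section Jacobiator.
Context {F : fieldType} {V : lmodType F} (br : V -> V -> V).
Hypothesis br_linearl : forall y, linear (br^~ y).
Hypothesis br_linearr : forall x, linear (br x).

Definition jacobiator (x y z : V) : V :=
  br x (br y z) + br y (br z x) + br z (br x y).

Lemma jacobiator_cycle (x y z : V) : jacobiator x y z = jacobiator y z x.
Proof. by rewrite /jacobiator -[LHS]addrA [LHS]addrC. Qed.

Lemma jacobiator_linear (y z : V) : linear (fun x => jacobiator x y z).
Proof.
move=> a x x'; rewrite /jacobiator.
have brl w b u v : br (b *: u + v) w = b *: br u w + br v w.
  exact: br_linearl.
have brr w b u v : br w (b *: u + v) = b *: br w u + br w v.
  exact: br_linearr.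
rewrite !(brl, brr).
by rewrite !scalerDr [X in X + _ = _]addrACA [LHS]addrACA.
Qed.

End Jacobiator.

Lemma double_eq0 (F : numFieldType) (V : lmodType F) (v : V) :
  v + v = 0 -> v = 0.
Proof.
rewrite -{1 2}[v]scale1r -scalerDl => /eqP; rewrite scaler_eq0.
by rewrite -[1 + 1]/(2%:R) pnatr_eq0 => /eqP.
Qed.

Section StructureConstants.
Context {F : numFieldType}.

Definition half_odd (j : int) : F := j%:~R + 2^-1.

Lemma half_oddDl (m j : int) : half_odd (m + j) = m%:~R + half_odd j.
Proof. by rewrite /half_odd rmorphD /= addrA. Qed.

Lemma half_oddD (j k : int) : half_odd j + half_odd k = (j + k + 1)%:~R.
Proof. by rewrite /half_odd !rmorphD /=; field. Qed.

Context {V : lmodType F} (b : mhv_index -> V).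

(* The bracket of the i-th and j-th basis vectors, written for a family b in
   an arbitrary vector space. *)
Definition mhv_basis_lie (i j : mhv_index) : V :=
  match i, j with
  | iL m, iL n => (m - n)%:~R *: b (iL (m + n))
      + ((m + n == 0)%:R * ((m ^+ 3 - m)%:~R / 12)) *: b ic
  | iL m, iI r => (- half_odd r) *: b (iI (m + r))
  | iI r, iL m => half_odd r *: b (iI (m + r))
  | iI r, iI s => (half_odd r * (half_odd r + half_odd s == 0)%:R) *: b il
  | _, _ => 0
  end.

Lemma half_oddD_eq0 (j k : int) :
  (half_odd j + half_odd k == 0) = (j + k + 1 == 0).
Proof. by rewrite half_oddD intr_eq0. Qed.

Lemma mhv_basis_lie_antisym (i j : mhv_index) :
  mhv_basis_lie i j + mhv_basis_lie j i = 0.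
Proof.
case: i j => [m|r||] [n|s||] //=; rewrite ?addr0 //.
- rewrite [n + m]addrC addrACA -!scalerDl -rmorphD /=.
  have -> : m - n + (n - m) = 0 by ring.
  rewrite scale0r add0r; case: eqP => [mn|_]; last by rewrite !mul0r addr0 scale0r.
  rewrite !mul1r -mulrDl -rmorphD /=.
  have -> : n = - m by apply/eqP; rewrite -addr_eq0 addrC mn.
  have -> : m ^+ 3 - m + ((- m) ^+ 3 - (- m)) = 0 by ring.
  by rewrite mul0r scale0r.
- by rewrite -scalerDl addNr scale0r.
- by rewrite -scalerDl subrr scale0r.
- rewrite [half_odd s + _]addrC -scalerDl -mulrDl.
  by case: eqP => [->|_]; rewrite ?mul0r ?mulr0 scale0r.
Qed.

Variable br : V -> V -> V.
Hypothesis br_linearr : forall x, linear (br x).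
Hypothesis br_b : forall i j, br (b i) (b j) = mhv_basis_lie i j.

Lemma mhv_basis_jacobi (i j k : mhv_index) :
  jacobiator br (b i) (b j) (b k) = 0.
Proof.
have br0 x : br x 0 = 0.
  by have := br_linearr x (-1) 0 0; rewrite scaler0 addr0 scaleN1r addNr.
have brD x y z : br x (y + z) = br x y + br x z.
  by have := br_linearr x 1 y z; rewrite !scale1r.
have brZ x a y : br x (a *: y) = a *: br x y.
  by have := br_linearr x a y 0; rewrite br0 !addr0.
rewrite /jacobiator !br_b.
case: i j k => [m|r||] [n|s||] [p|t||] /=;
  rewrite ?(brD, brZ, br0, br_b) /= ?(scaler0, addr0, add0r) //.
- have -> : n + (p + m) = m + (n + p) by ring.
  have -> : p + (m + n) = m + (n + p) by ring.
  rewrite !scalerDr !scalerA [X in X + _ = _]addrACA [LHS]addrACA -!scalerDl.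
  have -> : (n - p)%:~R * (m - (n + p))%:~R + (p - m)%:~R * (n - (p + m))%:~R
            + (m - n)%:~R * (p - (m + n))%:~R = 0 :> F by rewrite !rmorphD /=; ring.
  rewrite scale0r add0r; case: eqP => [mnp|_].
    have -> : m = - (n + p) by apply/eqP; rewrite -addr_eq0 mnp.
    rewrite -[RHS](scale0r (b ic)) !mul1r; congr (_ *: _).
    by rewrite !(rmorphB, rmorphD, rmorphN, rmorphXn) /=; field.
  by rewrite !(mul0r, mulr0) !addr0 scale0r.
- have -> : n + (m + t) = m + n + t by ring.
  rewrite addrA !scalerA -!scalerDl !half_oddDl rmorphB /=.
  by rewrite -[RHS](scale0r (b (iI (m + n + t)))); congr (_ *: _); ring.
- have -> : m + (p + s) = p + m + s by ring.
  rewrite addrA !scalerA -!scalerDl !half_oddDl rmorphB /=.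
  by rewrite -[RHS](scale0r (b (iI (p + m + s)))); congr (_ *: _); ring.
- rewrite !half_oddDl addrCA [half_odd s + _]addrC addrCA !scalerA -scalerDl.
  by rewrite -[RHS](scale0r (b il)); congr (_ *: _); ring.
- have -> : p + (n + r) = n + p + r by ring.
  rewrite addrA !scalerA -!scalerDl !half_oddDl rmorphB /=.
  by rewrite -[RHS](scale0r (b (iI (n + p + r)))); congr (_ *: _); ring.
- rewrite !half_oddDl addrCA [half_odd r + _]addrC addrCA !scalerA -scalerDl.
  by rewrite -[RHS](scale0r (b il)); congr (_ *: _); ring.
- rewrite !half_oddDl addrCA [half_odd r + _]addrC addrCA !scalerA -scalerDl.
  by rewrite -[RHS](scale0r (b il)); congr (_ *: _); ring.
Qed.

End StructureConstants.

Definition MHV (F : numFieldType) : Type := {malg F[mhv_index]}.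

Section MirrorHeisenbergVirasoro.
Context {F : numFieldType}.

HB.instance Definition _ := GRing.Lmodule.on (MHV F).

Definition mhv_basis (i : mhv_index) : MHV F := << 1 *g i >>.

Lemma mhv_linear0 (V : lmodType F) (f : MHV F -> V) :
  linear f -> (forall i, f (mhv_basis i) = 0) -> forall x, f x = 0.
Proof. exact: linear_malg0. Qed.

Lemma mhv_cyclic_linear0 (J : MHV F -> MHV F -> MHV F -> MHV F) :
  (forall x y z, J x y z = J y z x) ->
  (forall y z, linear (fun x => J x y z)) ->
  (forall i j k, J (mhv_basis i) (mhv_basis j) (mhv_basis k) = 0) ->
  forall x y z, J x y z = 0.
Proof.
move=> JC linJ J0.
have Jlin y z (H : forall i, J (mhv_basis i) y z = 0) x : J x y z = 0.
  exact: (mhv_linear0 (linJ y z) H x).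
move=> x y z; apply: (Jlin) => i; rewrite JC.
apply: (Jlin) => j; rewrite JC.
by apply: (Jlin) => k; rewrite JC.
Qed.

Definition mhv_lie (x y : MHV F) : MHV F :=
  linext (fun i => linext (mhv_basis_lie mhv_basis i) y) x.

Lemma mhv_lie_linearl (y : MHV F) : linear (mhv_lie^~ y).
Proof. exact: linext_linear. Qed.

Lemma mhv_lie_linearr (x : MHV F) : linear (mhv_lie x).
Proof.
move=> a y z; rewrite /mhv_lie {1 3 5}/linext scaler_sumr -big_split /=.
by apply: eq_bigr => k _; rewrite linext_linear scalerDr !scalerA mulrC.
Qed.

Lemma mhv_lie_basis (i j : mhv_index) :
  mhv_lie (mhv_basis i) (mhv_basis j) = mhv_basis_lie mhv_basis i j.
Proof. by rewrite /mhv_lie !linextU. Qed.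

Lemma mhv_lie_antisym (x y : MHV F) : mhv_lie x y + mhv_lie y x = 0.
Proof.
move: x; apply: linear_malg0 => [a x x'|i].
  by rewrite mhv_lie_linearl mhv_lie_linearr scalerDr addrACA.
move: y; apply: linear_malg0 => [a y y'|j].
  by rewrite mhv_lie_linearl mhv_lie_linearr scalerDr addrACA.
by rewrite !mhv_lie_basis mhv_basis_lie_antisym.
Qed.

Lemma mhv_liexx (x : MHV F) : mhv_lie x x = 0.
Proof. exact/double_eq0/mhv_lie_antisym. Qed.

Lemma mhv_lie_jacobi (x y z : MHV F) :
  mhv_lie x (mhv_lie y z) + mhv_lie y (mhv_lie z x) + mhv_lie z (mhv_lie x y)
  = 0.
Proof.
apply: (mhv_cyclic_linear0 (J := jacobiator mhv_lie)) => [u v w|v w|i j k].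
- exact: jacobiator_cycle.
- apply: jacobiator_linear; [exact: mhv_lie_linearl|exact: mhv_lie_linearr].
exact: mhv_basis_jacobi mhv_lie_linearr mhv_lie_basis _ _ _.
Qed.

Definition mhv_tau : MHV F -> MHV F :=
  linext (fun i =>
    match i with
    | iI _ => mhv_basis i
    | il => 2 *: mhv_basis il
    | iL _ | ic => 0
    end).

HB.instance Definition _ := Lmodule_isLieAlgebra.Build F (MHV F)
  mhv_lie_linearl mhv_lie_linearr mhv_liexx mhv_lie_jacobi.

End MirrorHeisenbergVirasoro.

(* Main.v *)
Require Import Defs.
From HB Require Import structures.
From mathcomp Require Import all_boot all_order all_algebra.
From mathcomp Require Import boolp classical_sets functions reals.
From mathcomp.real_closed Require Import complex.
From mathcomp Require Import ring zify.
From mathcomp.multinomials Require Import monalg.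

Set Implicit Arguments.
Unset Strict Implicit.
Unset Printing Implicit Defensive.

Import Order.TTheory GRing.Theory Num.Theory.
Local Open Scope ring_scope.
Local Open Scope classical_set_scope.

(** A delta-derivation f is determined by its homogeneous components, which can
    be read off coordinatewise: for each shift j, the numbers a n, defined as
    the coordinate of f(L_n) at L_(n+j) or at I_(n+j+1/2), satisfy a linear
    relation indexed by pairs (m, n) coming from [L_m, L_n] ([Der_shift_rel]).

    The instance m = 0 expresses a n by a 0 with at most one resonant exception,
    when delta is not 1. Substituting back gives a polynomial identity in m and
    n whose leading coefficient is nonzero unless delta is 0, 1 or 1/2; hence a
    vanishes ([shift_relL_eq0], [shift_relI_eq0]). For delta = 1/2 the numbers
    a n are constant in n. The shift j = 0 is accounted for by multiples of the
    identity, and the other shifts are excluded by the central term of the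
    Virasoro bracket ([Der_half_eq0]). For delta = 1 one first subtracts an
    inner derivation so that f(L_0) has no coordinate of nonzero degree and the
    L_1-coordinate of f(L_1) is zero ([Der1_decomp]); the relation then again
    gives a = 0.

    In all cases the normalized f takes central values on the L_n, hence
    vanishes on the Virasoro subalgebra, which is perfect
    ([Der_eq0_on_Virasoro]). What is left is the identity on [L_m, I_r]: it
    forces f(I_r) = 0 if delta is not 1 ([Der_eq0_of_L]), and f(I_r) = b I_r
    with a common scalar b if delta = 1, so that f = b tau ([Der1_tau]). For
    delta = 0 perfectness alone gives f = 0 on the Virasoro subalgebra. *)

(** * Scalar recurrences *)

Section ShiftRelation.
Context {F : numFieldType}.
Implicit Types (delta b d : F) (a : int -> F).

(** Let W be a module with basis v_k on which L_m acts by
    [L_m v_k = (b m - k) v_(m+k)]; here b = 1 is the span of the L_k modulo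
    the centre and b = 0 is the span of the I_r. The relation says that [L_n |-> a n *: v_(n+d)]
    satisfies the delta-derivation identity on all brackets of L_m and L_n. *)
Definition shift_rel delta b d a := forall m n : int,
  (m - n)%:~R * a (m + n) =
    delta * (m%:~R + d - b * n%:~R) * a m
    + delta * (b * m%:~R - n%:~R - d) * a n.

(** Bracketing with L_0 determines a n from a 0, unless n is the zero of an
    affine function of slope 1 - delta. *)
Lemma shift_rel_at0 delta b d a : shift_rel delta b d a ->
  forall n : int, (n%:~R - delta * (n%:~R + d)) * a n
    = delta * (b * n%:~R - d) * a 0.
Proof.
move=> E n; have := E 0 n; rewrite (add0r n) (sub0r n) rmorphN /= => e.
have -> : (n%:~R - delta * (n%:~R + d)) * a n =
  - (- n%:~R * a n) - delta * (n%:~R + d) * a n by ring.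
by rewrite e; ring.
Qed.

(** Only a single resonant index could survive a 0 = 0, and the relation
    expresses its value by those at two other indices. *)
Lemma shift_rel_eq0 delta b d a : delta != 1 -> shift_rel delta b d a ->
  a 0 = 0 -> forall n, a n = 0.
Proof.
move=> d1 E a0 n; apply/eqP; apply: contraT => an.
have P k : (k%:~R - delta * (k%:~R + d)) * a k = 0.
  by rewrite (shift_rel_at0 E) a0 mulr0.
have Pn : n%:~R - delta * (n%:~R + d) = 0.
  by apply/eqP; rewrite -(mulIr_eq0 _ (mulIf an)) P.
have a_off m : m != n -> a m = 0.
  move=> mn; apply/eqP; move/eqP: (P m); rewrite mulf_eq0 => /orP[|//].
  have -> : m%:~R - delta * (m%:~R + d) = (m - n)%:~R * (1 - delta).
    by rewrite -[LHS]subr0 -Pn rmorphB /=; ring.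
  by rewrite mulf_eq0 intr_eq0 !subr_eq0 (negPf mn) eq_sym (negPf d1).
(* n is a sum of two distinct integers, both different from n *)
have := E (n + (`|n| + 1)) (- (`|n| + 1)).
rewrite addrK (a_off (n + _)) ?(a_off (- _)); [|lia..].
move/eqP; rewrite !mulr0 addr0 mulf_eq0 (negPf an) orbF intr_eq0.
lia.
Qed.

(** Eliminating a m, a n and a (m + n) with [shift_rel_at0] turns the relation
    into a polynomial in (m, n), times a 0, that vanishes at all integer
    points. Its leading form is a multiple of (1 - delta)^2 (1 - 2 delta). This
    coefficient is extracted as a fourth difference along the line m = 2n;
    clearing the denominators first makes resonances harmless. *)
Lemma shift_relL_eq0 delta d a : delta != 0 -> delta != 1 -> delta != 2^-1 ->
  shift_rel delta 1 d a -> forall n, a n = 0.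
Proof.
move=> d0 d1 d2 E; apply: (shift_rel_eq0 d1 E).
(* P n is the coefficient of a n in shift_rel_at0; Q t arises from the
   instance m = 2t, n = t after multiplication by P t * P (2t) * P (3t) *)
pose P (n : F) := n - delta * (n + d).
pose Q (t : F) := t * (3 * t - d) * (P t * P (2 * t))
  - delta * (t + d) * (2 * t - d) * (P t * P (3 * t))
  - delta * (t - d) * (t - d) * (P (2 * t) * P (3 * t)).
have Q0 (t : int) : Q t%:~R * (delta * a 0) = 0.
  have e := E (2 * t) t.
  have h1 := shift_rel_at0 E t.
  have h2 := shift_rel_at0 E (2 * t).
  have h3 := shift_rel_at0 E (3 * t).
  have t3 : 2 * t + t = 3 * t by ring.
  have t1 : 2 * t - t = t by ring.
  rewrite t3 t1 in e; rewrite !rmorphM /= in e h2 h3.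
  rewrite -/(P _) in h1; rewrite -/(P _) in h2; rewrite -/(P _) in h3.
  transitivity (t%:~R * (P t%:~R * P (2 * t%:~R))
        * (delta * (1 * (3 * t%:~R) - d) * a 0)
     - delta * (t%:~R + d) * (P t%:~R * P (3 * t%:~R))
        * (delta * (1 * (2 * t%:~R) - d) * a 0)
     - delta * (t%:~R - d) * (P (2 * t%:~R) * P (3 * t%:~R))
        * (delta * (1 * t%:~R - d) * a 0)).
    by rewrite /Q; ring.
  rewrite -h1 -h2 -h3.
  transitivity (P t%:~R * P (2 * t%:~R) * P (3 * t%:~R) *
    (t%:~R * a (3 * t) - delta * (t%:~R + d) * a (2 * t)
       - delta * (t%:~R - d) * a t)).
    by ring.
  by rewrite e; ring.
(* 144 = 4! * 6: the fourth difference of the leading term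
   6 (1 - delta)^2 (1 - 2 delta) t^4 of Q *)
have : 144 * (1 - delta) ^+ 2 * (1 - 2 * delta) * (delta * a 0) = 0.
  transitivity (Q (2%:Z)%:~R * (delta * a 0)
    - 4 * (Q (1%:Z)%:~R * (delta * a 0))
    + 6 * (Q (0%:Z)%:~R * (delta * a 0)) - 4 * (Q (-1%:Z)%:~R * (delta * a 0))
    + Q (-2%:Z)%:~R * (delta * a 0)).
    by rewrite /Q /P; ring.
  by rewrite !Q0 !mulr0; ring.
move/eqP; rewrite !mulf_eq0 pnatr_eq0 /= !subr_eq0.
rewrite [1 == delta]eq_sym (negPf d1) (negPf d0) /=.
have -> : (1 == 2 * delta) = false.
  apply: contraNF d2 => /eqP h; apply/eqP.
  by apply: (@mulfI _ 2); rewrite ?pnatr_eq0 // -h divff // pnatr_eq0.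
by move/eqP.
Qed.

Lemma shift_relL_half_const a (delta : F) : delta = 2^-1 ->
  forall d, shift_rel delta 1 d a -> forall n, a n = a 0.
Proof.
(* constants solve the relation at 2^-1, so a - a 0 solves it as well *)
move=> -> d E n; apply/eqP; rewrite -subr_eq0; apply/eqP; move: n.
apply: (@shift_rel_eq0 2^-1 1 d (fun n => a n - a 0)); last by rewrite subrr.
  by rewrite invr_eq1 (eqr_nat F 2 1).
by move=> m n; rewrite mulrBr E rmorphB /=; field.
Qed.

(** The same elimination as for b = 1 now leaves a single monomial, with the
    factor (1 - delta)^2 d; half-integral shifts d are never zero. *)
Lemma shift_relI_eq0 delta d a : delta != 0 -> delta != 1 -> d != 0 ->
  shift_rel delta 0 d a -> forall n, a n = 0.
Proof.
move=> d0 d1 dd0 E; apply: (shift_rel_eq0 d1 E).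
have h1 := shift_rel_at0 E 1.
have h2 := shift_rel_at0 E 2.
have h3 := shift_rel_at0 E 3.
have := E 2 1; rewrite [2 + 1 : int]/(3 : int) [2 - 1 : int]/(1 : int) => e.
pose P (n : F) := n - delta * (n + d).
rewrite -/(P _) in h1; rewrite -/(P _) in h2; rewrite -/(P _) in h3.
(* P m * P n + delta * d * P (m + n) = (1 - delta)^2 * m * n, at (2, 1) *)
have : 2 * (1 - delta) ^+ 2 * (- delta * d * a 0) = 0.
  transitivity (P 1 * P 2 * (delta * (0 * 3 - d) * a 0)
     - delta * (2 + d) * (P 1 * P 3) * (delta * (0 * 2 - d) * a 0)
     + delta * (1 + d) * (P 2 * P 3) * (delta * (0 * 1 - d) * a 0)).
    by rewrite /P; ring.
  rewrite -h1 -h2 -h3.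
  transitivity (P 1 * P 2 * P 3 *
    (1%:~R * a 3 - delta * (2 + d) * a 2 + delta * (1 + d) * a 1)).
    by ring.
  by rewrite e; ring.
move/eqP; rewrite !mulf_eq0 pnatr_eq0 /= subr_eq0 oppr_eq0.
by rewrite [1 == delta]eq_sym (negPf d1) (negPf d0) (negPf dd0) => /eqP.
Qed.

(** For delta = 1 the relation with L_0 reads [- d * a n = (b n - d) * a 0]. *)
Lemma shift_rel_one_eq0 b d a : a 0 = 0 -> d != 0 ->
  shift_rel 1 b d a -> forall n, a n = 0.
Proof.
move=> a0 dd0 E n; have := shift_rel_at0 E n.
rewrite a0 mulr0 => /eqP; rewrite mulf_eq0 => /orP[|/eqP//].
by rewrite mul1r opprD addNKr oppr_eq0 (negPf dd0).
Qed.

(** The relation makes a additive on pairs of distinct integers. Adding 1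
    repeatedly to a negative integer avoids equal pairs, and so does adding an
    integer to its opposite. *)
Lemma shift_rel_one_additive_eq0 a : a 1 = 0 ->
  shift_rel 1 1 0 a -> forall n, a n = 0.
Proof.
move=> a1 E.
have E' m n : m != n -> a (m + n) = a m + a n.
  move=> mn; apply: (@mulfI _ (m - n)%:~R); first by rewrite intr_eq0 subr_eq0.
  by rewrite E rmorphB /=; ring.
have a0 : a 0 = 0.
  have /eqP := E' 1 0 isT.
  by rewrite addr0 -subr_eq0 opprD addNKr oppr_eq0 => /eqP.
have neg (n : nat) : a (- n%:Z) = 0.
  elim: n => [|n IH]; first by rewrite oppr0.
  have := E' 1 (- n.+1%:Z) isT; rewrite a1 add0r => <-.
  by rewrite (_ : 1 + - n.+1%:Z = - n%:Z) //; lia.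
case=> [[|n]|n]; first exact: a0.
- have := E' n.+1%:Z (- n.+1%:Z) isT.
  by rewrite subrr a0 neg addr0.
- by rewrite NegzE neg.
Qed.

End ShiftRelation.

(** * Delta-derivations of a Lie algebra *)

Section LieAlgebraDerivations.
Context {F : fieldType} {L : lieAlgType F}.

HB.instance Definition _ (x : L) :=
  GRing.isLinear.Build F L L *:%R (lie x) (lie_linearr x).

Lemma lieDl (x y z : L) : lie (x + y) z = lie x z + lie y z.
Proof. by have := lie_linearl z 1 x y; rewrite !scale1r. Qed.

Lemma lieDr (x y z : L) : lie x (y + z) = lie x y + lie x z.
Proof. exact: linearD. Qed.

Lemma lieZr (a : F) (x y : L) : lie x (a *: y) = a *: lie x y.
Proof. exact: linearZ. Qed.

Lemma lieC (x y : L) : lie x y = - lie y x.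
Proof.
have := liexx (x + y); rewrite !(lieDl, lieDr) !liexx add0r addr0.
by move/eqP; rewrite addr_eq0 => /eqP.
Qed.

Lemma lieZl (a : F) (x y : L) : lie (a *: x) y = a *: lie x y.
Proof. by rewrite lieC lieZr -scalerN -lieC. Qed.

Lemma lie0l (y : L) : lie 0 y = 0.
Proof. by rewrite lieC linear0 oppr0. Qed.

Lemma linear_funD {V W : lmodType F} (f : V -> W) : linear f ->
  forall x y, f (x + y) = f x + f y.
Proof. by move=> lf x y; have := lf 1 x y; rewrite !scale1r. Qed.

Lemma linear_fun0 {V W : lmodType F} (f : V -> W) : linear f -> f 0 = 0.
Proof.
move=> lf; have := linear_funD lf 0 0; rewrite addr0 => /eqP.
by rewrite -subr_eq0 opprD addNKr oppr_eq0 => /eqP.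
Qed.

Lemma linear_funZ {V W : lmodType F} (f : V -> W) : linear f ->
  forall a x, f (a *: x) = a *: f x.
Proof.
by move=> lf a x; have := lf a x 0; rewrite (linear_fun0 lf) !addr0.
Qed.

Lemma Der_linear delta (f : L -> L) : Der L delta f -> linear f.
Proof. by case. Qed.

Lemma Der_lie delta (f : L -> L) : Der L delta f -> forall x y,
  f (lie x y) = delta *: (lie (f x) y + lie x (f y)).
Proof. by move=> [_ H] x y; rewrite H scalerDr. Qed.

Lemma DerD delta (f g : L -> L) :
  Der L delta f -> Der L delta g -> Der L delta (f + g).
Proof.
move=> [lf df] [lg dg]; split=> [a x y|x y]; rewrite !addrfctE.
  by rewrite lf lg scalerDr addrACA.
by rewrite df dg lieDl lieDr !scalerDr addrACA.
Qed.

Lemma DerZ delta a (f : L -> L) : Der L delta f -> Der L delta (a *: f).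
Proof.
move=> [lf df]; split=> [b x y|x y]; rewrite !fctE.
  by rewrite lf scalerDr !scalerA mulrC.
by rewrite df lieZl lieZr scalerDr !scalerA mulrC.
Qed.

Lemma Der0 delta : Der L delta 0.
Proof.
split=> [a x y|x y].
  by change (0 = a *: 0 + 0 :> L); rewrite scaler0 addr0.
change (0 = delta *: lie 0 y + delta *: lie x 0).
by rewrite lie0l !linear0 addr0.
Qed.

Lemma Der_ad (x : L) : Der L 1 (lie x).
Proof.
split=> [|y z]; first exact: lie_linearr.
have /eqP := lie_jacobi x y z.
rewrite -addrA addr_eq0 => /eqP ->; rewrite !scale1r opprD addrC.
by rewrite [lie z _]lieC opprK [lie z x]lieC linearN opprK.
Qed.

Lemma Der_id : 2 != 0 :> F -> Der L 2^-1 id.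
Proof.
move=> h; split=> // x y; rewrite -scalerDl -mulr2n -[2^-1 *+ 2]mulr_natr.
by rewrite mulVf // scale1r.
Qed.

End LieAlgebraDerivations.

(** * Coordinates for the structure constants *)

Section Indices.
Context {F : numFieldType}.

(** The non-central basis vectors under one name, so that the L- and the
    I-coordinates are treated by the same computations. *)
Definition idx (t : bool) (k : int) : mhv_index := if t then iL k else iI k.

(** Minus the eigenvalue of ad L_0 on the basis vector [idx t k]. *)
Definition weight (t : bool) (k : int) : F := if t then k%:~R else half_odd k.

Lemma weightDl t m k : weight t (m + k) = m%:~R + weight t k.
Proof. by case: t; rewrite /weight ?half_oddDl // rmorphD. Qed.

Lemma half_odd_neq0 j : half_odd j != 0 :> F.
Proof.
apply/eqP => h; have : (2 * j + 1)%:~R = 0 :> F.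
  by rewrite rmorphD rmorphM /= -(mulr0 2) -h /half_odd; field.
by move/eqP; rewrite intr_eq0; lia.
Qed.

Definition virasoro_cocycle (m : int) : F := (m ^+ 3 - m)%:~R / 12.

End Indices.

(** A Lie algebra with a basis e having the structure constants of the mirror
    Heisenberg-Virasoro algebra. The basis is given by its universal property:
    ext is linear extension from e. *)
Section Coordinates.
Context {F : numFieldType} (V : lieAlgType F) (e : mhv_index -> V).
Context (ext : forall W : lmodType F, (mhv_index -> W) -> V -> W).
Context (ext_linear : forall (W : lmodType F) (u : mhv_index -> W),
  linear (ext u)).
Context (ext_e : forall (W : lmodType F) (u : mhv_index -> W) i,
  ext u (e i) = u i).
Context (linear0_of_e : forall (W : lmodType F) (f : V -> W),
  linear f -> (forall i, f (e i) = 0) -> forall x, f x = 0).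
Context (coord_eq0 : forall x : V,
  (forall i, ext (fun j => (j == i)%:R : F^o) x = 0) -> x = 0).
Context (lie_e : forall i j, lie (e i) (e j) = mhv_basis_lie e i j).

Implicit Types (x y : V) (delta : F) (f : V -> V).

Definition coef (i : mhv_index) x : F := ext (fun j => (j == i)%:R : F^o) x.

Lemma coefD i x y : coef i (x + y) = coef i x + coef i y.
Proof. exact: (linear_funD (@ext_linear F^o _)). Qed.

Lemma coefZ i a x : coef i (a *: x) = a * coef i x.
Proof. exact: (linear_funZ (@ext_linear F^o _)). Qed.

Lemma coef0 i : coef i 0 = 0.
Proof. exact: (linear_fun0 (@ext_linear F^o _)). Qed.

Lemma coef_eq0 x : (forall i, coef i x = 0) -> x = 0.
Proof. exact: coord_eq0. Qed.

Lemma coefN i x : coef i (- x) = - coef i x.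
Proof. by rewrite -scaleN1r coefZ mulN1r. Qed.

Lemma coef_e i j : coef i (e j) = (j == i)%:R.
Proof. exact: (@ext_e F^o). Qed.

Lemma eq_of_e (W : lmodType F) (f g : V -> W) :
  linear f -> linear g -> (forall i, f (e i) = g (e i)) -> f =1 g.
Proof.
move=> lf lg fg x; apply/eqP; rewrite -subr_eq0; apply/eqP.
apply: (linear0_of_e (f := fun x => f x - g x)) => [a y z|i].
  by rewrite lf lg scalerBr opprD addrACA.
by rewrite fg subrr.
Qed.

Lemma coef_lieL m t k x :
  coef (idx t k) (lie (e (iL m)) x) =
    (t%:R * m%:~R - weight t (k - m)) * coef (idx t (k - m)) x.
Proof.
move: x; apply: (@eq_of_e F^o).
- by move=> a x y; rewrite lieDr lieZr coefD coefZ.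
- by move=> a x y; rewrite coefD coefZ mulrDr /= mulrCA.
have eqs (n : int) : (m + n == k) = (n == k - m).
  by rewrite addrC eq_sym -subr_eq eq_sym.
case=> [n|n||]; rewrite lie_e /= ?(coefD, coefZ, coef0, coef_e).
all: case: t => /=; rewrite ?mulr0 ?addr0 //.
- rewrite -[iL _ == _]/(m + n == k) -[iL _ == _]/(n == k - m) eqs.
  by case: eqP => [->|]; rewrite ?mulr0 // !mulr1 mul1r rmorphB.
- rewrite -[iI _ == _]/(m + n == k) -[iI _ == _]/(n == k - m) eqs.
  by case: eqP => [->|]; rewrite ?mulr0 // mul0r sub0r.
Qed.

Lemma coef_lieL_c m x :
  coef ic (lie (e (iL m)) x) = virasoro_cocycle m * coef (iL (- m)) x.
Proof.
move: x; apply: (@eq_of_e F^o).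
- by move=> a x y; rewrite lieDr lieZr coefD coefZ.
- by move=> a x y; rewrite coefD coefZ mulrDr /= mulrCA.
case=> [n|n||]; rewrite lie_e /= ?(coefD, coefZ, coef0, coef_e).
all: rewrite ?mulr0 ?addr0 //.
rewrite eqxx add0r mulr1 -[iL _ == _]/(n == - m) [m + n]addrC addr_eq0.
by rewrite mulrC.
Qed.

Lemma coef_lieL_l m x : coef il (lie (e (iL m)) x) = 0.
Proof.
move: x; apply: (@eq_of_e F^o).
- by move=> a x y; rewrite lieDr lieZr coefD coefZ.
- by move=> a x y; rewrite scaler0 addr0.
case=> [n|n||]; rewrite lie_e /= ?(coefD, coefZ, coef0, coef_e).
all: by rewrite ?mulr0 ?addr0.
Qed.

Lemma lie_c x : lie (e ic) x = 0.
Proof.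
move: x; apply: linear0_of_e; first exact: lie_linearr.
by move=> i; rewrite lie_e.
Qed.

Lemma lie_l x : lie x (e il) = 0.
Proof.
move: x; apply: linear0_of_e; first exact: lie_linearl.
by case=> *; rewrite lie_e.
Qed.

Lemma lieLL m n : lie (e (iL m)) (e (iL n)) = (m - n)%:~R *: e (iL (m + n))
   + ((m + n == 0)%:R * virasoro_cocycle m) *: e ic.
Proof. exact: lie_e. Qed.

Lemma lieLI m r : lie (e (iL m)) (e (iI r)) = - half_odd r *: e (iI (m + r)).
Proof. exact: lie_e. Qed.

Lemma lieL_central x : (forall t k, coef (idx t k) x = 0) ->
  forall m, lie (e (iL m)) x = 0.
Proof.
move=> x0 m; apply: coef_eq0 => -[k|k||].
- by rewrite (coef_lieL m true k) x0 mulr0.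
- by rewrite (coef_lieL m false k) x0 mulr0.
- by rewrite coef_lieL_c (x0 true) mulr0.
- by rewrite coef_lieL_l.
Qed.

(** * Reduction to scalar recurrences *)

(** Applying f to [c, y] = 0 gives delta [f(c), y] = 0; no other vector than a
    central one commutes with all the L_m. *)
Lemma Der_coef_c_image delta f : delta != 0 -> Der V delta f ->
  forall t k, coef (idx t k) (f (e ic)) = 0.
Proof.
move=> d0 df.
have H m : lie (e (iL m)) (f (e ic)) = 0.
  have := Der_lie df (e (iL m)) (e ic).
  rewrite [lie (f _) _]lieC !lie_c oppr0 add0r.
  rewrite lieC lie_c oppr0 (linear_fun0 (Der_linear df)).
  by move/esym/eqP; rewrite scaler_eq0 (negPf d0) => /eqP.
move=> [] k.
- have := coef_lieL (k + 1) true (k + (k + 1)) (f (e ic)).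
  rewrite H coef0 addrK mul1r /weight rmorphD /= addrAC subrr add0r mul1r.
  by move=> <-.
- have := coef_lieL 0 false k (f (e ic)).
  rewrite H coef0 subr0 mul0r sub0r => /esym/eqP.
  by rewrite mulf_eq0 oppr_eq0 (negPf (half_odd_neq0 _)) => /eqP.
Qed.

Lemma Der_lieLL delta f : Der V delta f -> forall m n,
  (m - n)%:~R *: f (e (iL (m + n)))
    + ((m + n == 0)%:R * virasoro_cocycle m) *: f (e ic)
  = delta *: (lie (e (iL m)) (f (e (iL n))) - lie (e (iL n)) (f (e (iL m)))).
Proof.
move=> df m n; have := Der_lie df (e (iL m)) (e (iL n)).
have lf := Der_linear df.
by rewrite lieLL (linear_funD lf) !(linear_funZ lf) [lie (f _) _]lieC
  [- _ + _]addrC.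
Qed.

(** The homogeneous component of shift j of a delta-derivation, taken on
    coordinates; the central term of [L_m, L_n] does not contribute because f
    sends c to the centre. *)
Lemma Der_shift_rel delta f : delta != 0 -> Der V delta f ->
  forall (t : bool) j,
  shift_rel delta t%:R (weight t j)
    (fun n => coef (idx t (n + j)) (f (e (iL n)))).
Proof.
move=> d0 df t j m n /=.
have := congr1 (coef (idx t (m + n + j))) (Der_lieLL df m n).
rewrite coefD !coefZ (Der_coef_c_image d0 df) mulr0 addr0 coefD coefN.
rewrite !coef_lieL.
have -> : m + n + j - m = n + j by ring.
have -> : m + n + j - n = m + j by ring.
rewrite !weightDl => ->.
by ring.
Qed.

Lemma Der_coef_c delta f : Der V delta f -> forall m n,
  m + n != 0 ->
  (m - n)%:~R * coef ic (f (e (iL (m + n)))) =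
  delta * (virasoro_cocycle m * coef (iL (- m)) (f (e (iL n)))
           - virasoro_cocycle n * coef (iL (- n)) (f (e (iL m)))).
Proof.
move=> df m n mn.
have := congr1 (coef ic) (Der_lieLL df m n).
rewrite (negPf mn) mul0r scale0r addr0 !coefZ coefD coefN.
by rewrite !coef_lieL_c.
Qed.

(** The Virasoro subalgebra is perfect; the sum in the hypothesis is the value
    of a linear f at [L_m, L_n]. *)
Lemma eq0_on_Virasoro f :
  (forall m n, (m - n)%:~R *: f (e (iL (m + n)))
    + ((m + n == 0)%:R * virasoro_cocycle m) *: f (e ic) = 0) ->
  (forall n, f (e (iL n)) = 0) /\ f (e ic) = 0.
Proof.
move=> h.
have fL n : f (e (iL n)) = 0.
  have [->|n0] := eqVneq n 0.
    (* the cocycle vanishes at 1, so [L_1, L_{-1}] = 2 L_0 *)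
    have := h 1 (-1); rewrite /virasoro_cocycle !subrr.
    rewrite mul0r mulr0 scale0r addr0.
    by move/eqP; rewrite scaler_eq0 intr_eq0 => /eqP.
  have := h n 0; rewrite !(addr0 n) (negPf n0) mul0r scale0r addr0.
  by move/eqP; rewrite scaler_eq0 intr_eq0 (negPf n0) => /eqP.
split=> //; have := h 2 (-2).
rewrite subrr eqxx fL scaler0 add0r mul1r => /eqP.
rewrite scaler_eq0 /virasoro_cocycle mulf_eq0 invr_eq0 intr_eq0 pnatr_eq0 /=.
by move/eqP.
Qed.

Lemma Der_eq0_on_Virasoro delta f : Der V delta f ->
  (forall n t k, coef (idx t k) (f (e (iL n))) = 0) ->
  (forall n, f (e (iL n)) = 0) /\ f (e ic) = 0.
Proof.
move=> df f0; apply: eq0_on_Virasoro => m n.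
by rewrite (Der_lieLL df) !(lieL_central (f0 _)) subrr scaler0.
Qed.

Definition tau : V -> V := ext (fun i =>
  match i with iI _ => e i | il => 2 *: e il | iL _ | ic => 0 end).

Lemma tau_linear : linear tau.
Proof. exact: ext_linear. Qed.

Lemma tauE i : tau (e i) =
  match i with iI _ => e i | il => 2 *: e il | iL _ | ic => 0 end.
Proof. exact: ext_e. Qed.

Lemma Der_lieLI delta f : Der V delta f -> (forall n, f (e (iL n)) = 0) ->
  forall m r, - half_odd r *: f (e (iI (m + r)))
    = delta *: lie (e (iL m)) (f (e (iI r))).
Proof.
move=> df fL m r; have := Der_lie df (e (iL m)) (e (iI r)).
by rewrite lieLI (linear_funZ (Der_linear df)) fL lie0l add0r.
Qed.

Lemma Der_l delta f : Der V delta f ->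
  f (e il) = (2 * delta) *:
     (lie (f (e (iI 0))) (e (iI (-1))) + lie (e (iI 0)) (f (e (iI (-1))))).
Proof.
move=> df; have := Der_lie df (e (iI 0)) (e (iI (-1))).
rewrite lie_e /= half_oddD_eq0 /= mulr1 (linear_funZ (Der_linear df)).
move/(congr1 ( *:%R 2)); rewrite !scalerA /half_odd add0r divff ?pnatr_eq0 //.
by rewrite scale1r.
Qed.

Lemma DerI_coef_cl delta f :
  Der V delta f -> (forall n, f (e (iL n)) = 0) ->
  forall r, coef ic (f (e (iI r))) = 0 /\ coef il (f (e (iI r))) = 0.
Proof.
move=> df fL r; split.
  have := congr1 (coef ic) (Der_lieLI df fL 0 r).
  rewrite !coefZ coef_lieL_c /virasoro_cocycle subrr mul0r mul0r mulr0 add0r.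
  by move/eqP; rewrite mulf_eq0 oppr_eq0 (negPf (half_odd_neq0 _)) => /eqP.
have := congr1 (coef il) (Der_lieLI df fL 0 r).
rewrite !coefZ coef_lieL_l mulr0 add0r.
by move/eqP; rewrite mulf_eq0 oppr_eq0 (negPf (half_odd_neq0 _)) => /eqP.
Qed.

Lemma DerI_coef delta f : Der V delta f -> (forall n, f (e (iL n)) = 0) ->
  forall (t : bool) j m r,
   - half_odd r * coef (idx t (m + r + j)) (f (e (iI (m + r))))
   = delta * (t%:R * m%:~R - r%:~R - weight t j)
     * coef (idx t (r + j)) (f (e (iI r))).
Proof.
move=> df fL t j m r.
have := congr1 (coef (idx t (m + r + j))) (Der_lieLI df fL m r).
rewrite !coefZ coef_lieL.
have -> : m + r + j - m = r + j by ring.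
by rewrite weightDl => ->; ring.
Qed.

(** Once f kills the Virasoro subalgebra, its coordinates on the I_r satisfy a
    one-term recurrence in m and r. For delta different from 1 it forces them
    to vanish. *)
Lemma Der_eq0_of_L delta f : delta != 1 -> Der V delta f ->
  (forall n, f (e (iL n)) = 0) -> f (e ic) = 0 -> f = 0.
Proof.
move=> d1 df fL fc.
have fI (t : bool) j r : coef (idx t (r + j)) (f (e (iI r))) = 0.
  pose b r := coef (idx t (r + j)) (f (e (iI r))).
  have H m k : - half_odd k * b (m + k)
      = delta * (t%:R * m%:~R - k%:~R - weight t j) * b k.
    exact: DerI_coef.
  have H0 k : (half_odd k - delta * (k%:~R + weight t j)) * b k = 0.
    have := H 0 k; rewrite (add0r k) => h.
    by rewrite mulrBl -[half_odd k]opprK mulNr h; ring.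
  (* the factor in H0 is affine in k of slope 1 - delta, hence has at most one
     zero *)
  have [k bk] : exists k, b k = 0.
    have [b0|b0] := eqVneq (b 0) 0; first by exists 0.
    have [b1|b1] := eqVneq (b 1) 0; first by exists 1.
    have /eqP := H0 0; have /eqP := H0 1.
    rewrite !mulf_eq0 (negPf b0) (negPf b1) !orbF => /eqP h1 /eqP h0.
    case/eqP: d1; apply/eqP; rewrite eq_sym -subr_eq0 -h1.
    rewrite -[X in _ == X]subr0 -[X in _ == _ - X]h0 /half_odd.
    by apply/eqP; ring.
  have /eqP := H (r - k) k; rewrite bk mulr0 mulf_eq0 oppr_eq0.
  by rewrite (negPf (half_odd_neq0 _)) subrK => /eqP.
have fI0 r : f (e (iI r)) = 0.
  have [c0 l0] := DerI_coef_cl df fL r.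
  apply: coef_eq0 => -[k|k||] //.
  - by have := fI true (k - r) r; rewrite addrC subrK.
  - by have := fI false (k - r) r; rewrite addrC subrK.
apply/funext; apply: eq_of_e => [||i]; first exact: (Der_linear df).
  by move=> a x y; change (0 = a *: 0 + 0 :> V); rewrite linear0 addr0.
change (f (e i) = 0); case: i => //.
by rewrite (Der_l df) !fI0 lie0l linear0 addr0 scaler0.
Qed.

(** For delta = 1 the relation with L_0 only says that f preserves degrees, and
    the recurrence makes f a constant multiple of the identity on the span of
    the I_r. *)
Lemma Der1_tau f : Der V 1 f ->
  (forall n, f (e (iL n)) = 0) -> f (e ic) = 0 -> exists b, f = b *: tau.
Proof.
move=> df fL fc.
pose b := coef (iI 0) (f (e (iI 0))); exists b.
have fI r : f (e (iI r)) = b *: e (iI r).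
  have H0 (t : bool) j : ~~ (~~ t && (j == 0)) ->
      coef (idx t (r + j)) (f (e (iI r))) = 0.
    move=> tj; have := DerI_coef df fL t j 0 r.
    rewrite (add0r r) mulr0 sub0r mul1r.
    move/eqP; rewrite -subr_eq0 -mulrBl mulf_eq0 => /orP[|/eqP //].
    have -> : - half_odd r - (- r%:~R - weight t j) = weight t j - 2^-1 :> F.
      by rewrite /half_odd; ring.
    case: t tj => /= jn0.
      have -> : j%:~R - 2^-1 = half_odd (j - 1) :> F.
        by rewrite /half_odd rmorphB /=; field.
      by rewrite (negPf (half_odd_neq0 _)).
    by rewrite /half_odd addrK intr_eq0 (negPf jn0).
  have br : coef (iI r) (f (e (iI r))) = b.
    have := DerI_coef df fL false 0 r 0.
    rewrite !(addr0 r) mul0r mul1r.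
    have -> : 0 - 0%:~R - weight false 0 = - half_odd 0 :> F.
      by rewrite /weight; ring.
    by apply: mulfI; rewrite oppr_eq0 half_odd_neq0.
  have [c0 l0] := DerI_coef_cl df fL r.
  apply/eqP; rewrite -subr_eq0; apply/eqP; apply: coef_eq0 => i.
  rewrite coefD coefN coefZ coef_e; case: i => [k|k||].
  - have := H0 true (k - r) isT; rewrite [r + _]addrC subrK => ->.
    by rewrite mulr0 subr0.
  - rewrite -[iI r == _]/(r == k); have [<-|rk] := eqVneq r k.
      by rewrite br mulr1 subrr.
    have := H0 false (k - r); rewrite subr_eq0 [k == r]eq_sym rk => /(_ isT).
    by rewrite [r + _]addrC subrK => ->; rewrite mulr0 subr0.
  - by rewrite c0 mulr0 subr0.
  - by rewrite l0 mulr0 subr0.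
apply/funext; apply: eq_of_e => [||i].
- exact: (Der_linear df).
- by move=> a x y; rewrite !scalrfctE tau_linear scalerDr !scalerA mulrC.
rewrite scalrfctE tauE; case: i => [n|r||].
- by rewrite fL scaler0.
- exact: fI.
- by rewrite fc scaler0.
rewrite (Der_l df) !fI lieZl lieZr -scalerDr lie_e /= half_oddD_eq0 /=.
rewrite -scalerDl !scalerA; congr (_ *: _).
by rewrite /half_odd; field.
Qed.

Lemma Der_tau : Der V 1 tau.
Proof.
split; first exact: tau_linear.
move=> x y; rewrite !scale1r; move: x.
apply: eq_of_e => [a x z|a x z|i].
- by rewrite lieDl lieZl tau_linear.
- by rewrite tau_linear !lieDl !lieZl scalerDr addrACA.
move: y; apply: eq_of_e => [a x z|a x z|j].
- by rewrite lieDr lieZr tau_linear.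
- by rewrite tau_linear !lieDr !lieZr scalerDr addrACA.
have tD := linear_funD tau_linear; have tZ := linear_funZ tau_linear.
have t0 := linear_fun0 tau_linear.
case: i j => [m|r||] [n|s||];
  rewrite !tauE ?lieZl ?lieZr ?lie_e /= ?(tD, tZ, t0, tauE) ?lie0l ?linear0
    ?lie_e /= ?(scaler0, addr0, add0r) //.
by rewrite -mulr2n -scaler_nat !scalerA mulrC.
Qed.

Lemma Der_eq0_of_idx delta f : delta != 1 -> Der V delta f ->
  (forall n t k, coef (idx t k) (f (e (iL n))) = 0) -> f = 0.
Proof.
move=> d1 df f0; have [fL fc] := Der_eq0_on_Virasoro df f0.
exact: Der_eq0_of_L d1 df fL fc.
Qed.

Lemma coef_eq0_of_shifts f :
  (forall (t : bool) j n, coef (idx t (n + j)) (f (e (iL n))) = 0) ->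
  forall n t k, coef (idx t k) (f (e (iL n))) = 0.
Proof. by move=> H n t k; have := H t (k - n) n; rewrite addrC subrK. Qed.

(** * The three cases *)

Lemma Der0_eq0 f : Der V 0 f -> f = 0.
Proof.
move=> df; have [|fL fc] := @eq0_on_Virasoro f.
  by move=> m n; rewrite (Der_lieLL df) scale0r.
by apply: (Der_eq0_of_L _ df) => //; rewrite eq_sym oner_eq0.
Qed.

Lemma Der_generic_eq0 delta f : delta != 0 -> delta != 1 -> delta != 2^-1 ->
  Der V delta f -> f = 0.
Proof.
move=> d0 d1 d2 df; apply: (Der_eq0_of_idx d1 df).
apply: coef_eq0_of_shifts => -[] j; have := Der_shift_rel d0 df.
- by move/(_ true j); apply: shift_relL_eq0.
- by move/(_ false j); apply: shift_relI_eq0 => //; exact: half_odd_neq0.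
Qed.

(** For delta = 1/2 each homogeneous component is a shift L_n |-> a L_(n+j): the
    Witt algebra does have these extra solutions. For j nonzero the central
    charge rules them out: the c-coordinates of the identity on two pairs with
    sum - j contradict each other unless a = 0, because the cocycle is cubic. *)
Lemma Der_half_eq0 f : Der V 2^-1 f -> coef (iL 0) (f (e (iL 0))) = 0 -> f = 0.
Proof.
move=> df f00.
have d0 : 2^-1 != 0 :> F by rewrite invr_eq0 pnatr_eq0.
have d1 : 2^-1 != 1 :> F by rewrite invr_eq1 (eqr_nat F 2 1).
apply: (Der_eq0_of_idx d1 df); apply: coef_eq0_of_shifts => -[] j; last first.
  by apply: shift_relI_eq0 (Der_shift_rel d0 df false j) => //;
    exact: half_odd_neq0.
have al := shift_relL_half_const erefl (Der_shift_rel d0 df true j).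
move=> n; rewrite al {n} (add0r j).
have [->//|j0] := eqVneq j 0.
set a := coef _ _.
have {}al n k : k = n + j -> coef (iL k) (f (e (iL n))) = a.
  by move=> ->; have := al n; rewrite /= (add0r j).
pose g := coef ic (f (e (iL (- j)))).
have h m n : m + n = - j ->
    (m - n)%:~R * g = 2^-1 * (virasoro_cocycle m - virasoro_cocycle n) * a.
  move=> mn; have mn0 : m + n != 0 by rewrite mn oppr_eq0.
  have := Der_coef_c df mn0; rewrite mn -/g => ->.
  by rewrite !al; [ring|lia..].
(* - j = (- j) + 0 = (- 2j) + j; eliminate g between the two equations *)
have h1 := h (- j) 0 (addr0 _).
have h2 := h (- (2 * j)) j ltac:(lia).
have : j%:~R ^+ 3 * a = 0.
  transitivity (4 *
    (3 * (2^-1 * (virasoro_cocycle (- j) - virasoro_cocycle 0) * a)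
     - 2^-1 * (virasoro_cocycle (- (2 * j)) - virasoro_cocycle j) * a)).
    rewrite /virasoro_cocycle !(rmorphB, rmorphXn, rmorphN, rmorphM) /=.
    by field.
  rewrite -h1 -h2 !(rmorphB, rmorphN, rmorphM) /=; ring.
by move/eqP; rewrite mulf_eq0 expf_eq0 intr_eq0 (negPf j0) => /eqP.
Qed.

(** A derivation whose values on L_0 and L_1 are normalized as can be achieved
    by subtracting an inner derivation. *)
Lemma Der1_eq_tau f : Der V 1 f ->
  (forall t k, weight t k != 0 :> F -> coef (idx t k) (f (e (iL 0))) = 0) ->
  coef (iL 1) (f (e (iL 1))) = 0 -> exists b, f = b *: tau.
Proof.
move=> df f0 f1; have sh := Der_shift_rel (oner_neq0 F) df.
have H : forall n t k, coef (idx t k) (f (e (iL n))) = 0.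
  apply: coef_eq0_of_shifts => t j.
  have [w0|wn0] := eqVneq (weight t j : F) 0; last first.
    apply: (shift_rel_one_eq0 _ wn0 (sh t j)).
    by rewrite /= (add0r j) f0.
  case: t w0 => /eqP; last by rewrite (negPf (half_odd_neq0 _)).
  rewrite /weight intr_eq0 => /eqP ->.
  by apply: shift_rel_one_additive_eq0 (sh true 0) => /=;
    rewrite (addr0 (1 : int)).
have [fL fc] := Der_eq0_on_Virasoro df H.
exact: Der1_tau df fL fc.
Qed.

(** Since ad L_0 is diagonal, ad y can match any value of f at L_0 outside the
    kernel of ad L_0; a multiple of ad L_0 does not change that and adjusts the
    L_1-coordinate at L_1. *)
Lemma Der1_decomp f : Der V 1 f -> exists x b, f = lie x + b *: tau.
Proof.
move=> df.
pose wt i : F := match i with iL k => k%:~R | iI r => half_odd r | _ => 0 end.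
(* the central coordinates and that of L_0 have wt = 0, and 0^-1 = 0 drops
   them *)
pose y := ext (fun i => (wt i)^-1 *: e i) (f (e (iL 0))).
have coefy i : coef i y = (wt i)^-1 * coef i (f (e (iL 0))).
  rewrite /y; move: (f _); apply: (@eq_of_e F^o) => [a u v|a u v|j].
  - by rewrite ext_linear coefD coefZ.
  - by rewrite coefD coefZ mulrDr mulrCA.
  rewrite ext_e coefZ coef_e; case: eqP => [->//|_].
  by rewrite !mulr0.
pose c := coef (iL 1) (f (e (iL 1)) - lie y (e (iL 1))).
pose x := y - c *: e (iL 0).
have lx z : lie x z = lie y z - c *: lie (e (iL 0)) z.
  by rewrite /x lieDl -scaleNr lieZl scaleNr.
have dg : Der V 1 (f + (-1) *: lie x) by apply: DerD => //; apply/DerZ/Der_ad.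
have gE z : (f + (-1) *: lie x) z = f z - lie x z.
  by rewrite addrfctE scalrfctE scaleN1r.
have [|| b gb] := Der1_eq_tau dg.
- move=> t k wk; rewrite gE lx liexx scaler0 subr0 lieC opprK coefD.
  rewrite coef_lieL coefy subr0 mulr0 sub0r.
  have -> : wt (idx t k) = weight t k by case: (t).
  by rewrite mulNr mulVKf // subrr.
- rewrite gE lx lieLL coefD coefN coefD coefN coefZ coefD !coefZ !coef_e eqxx.
  rewrite /c coefD coefN (add0r (1 : int)) mul0r mul0r addr0 mulr1 sub0r.
  rewrite rmorphN; ring.
exists x, b; rewrite -gb; apply/funext => z.
by rewrite /= [RHS]addrC gE subrK.
Qed.

(** Inner derivations kill the central element l, whereas tau doubles it. *)
Lemma ad_tau_eq0 x b : lie x = b *: tau -> b = 0.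
Proof.
move=> xb; have := congr1 (@^~ (e il)) xb.
rewrite /= lie_l scalrfctE tauE => /(congr1 (coef il)).
rewrite coef0 !coefZ coef_e eqxx mulr1 => /esym/eqP.
by rewrite mulf_eq0 pnatr_eq0 orbF => /eqP.
Qed.

Lemma Der1_direct_sum : is_direct_sum (Der V 1) (Inn V) (line tau).
Proof.
split; apply/seteqP; split.
- move=> f /Der1_decomp [x [b ->]].
  by exists (lie x); [exists x|exists (b *: tau); [exists b|]].
- move=> _ [_ [x _ <-]] [_ [b _ <-]] <-.
  by apply: DerD; [exact: Der_ad|exact/DerZ/Der_tau].
- move=> _ [[x _ <-] [b _ /esym xb]] /=.
  by rewrite xb (ad_tau_eq0 xb) scale0r.
move=> _ ->; split.
  by exists 0 => //; apply/funext => x; rewrite lie0l.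
by exists 0 => //; rewrite scale0r.
Qed.

Lemma Der_half : Der V 2^-1 = line id.
Proof.
have did : Der V 2^-1 id by apply: Der_id; rewrite pnatr_eq0.
apply/seteqP; split => [f df|_ [a _ <-]]; last exact: DerZ.
pose a := coef (iL 0) (f (e (iL 0))); exists a => //.
have : f + (- a) *: id = 0.
  apply: Der_half_eq0; first by apply: DerD => //; exact: DerZ.
  by rewrite addrfctE scalrfctE coefD coefZ coef_e eqxx mulr1 subrr.
by rewrite scaleNr => /eqP; rewrite subr_eq0 => /eqP.
Qed.

Lemma Der_other delta : delta != 1 -> delta != 2^-1 -> Der V delta = [set 0].
Proof.
move=> d1 d2; apply/seteqP; split=> [f|_ ->]; last exact: Der0.
have [->|d0] := eqVneq delta 0; first by move/Der0_eq0.
by move/(Der_generic_eq0 d0 d1 d2).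
Qed.

End Coordinates.

(** * The mirror Heisenberg-Virasoro algebra *)

Lemma linext_delta (F : fieldType) (K : choiceType) (x : {malg F[K]}) k :
  linext (fun j => (j == k)%:R : F^o) x = mcoeff k x.
Proof.
apply/eqP; rewrite -subr_eq0; apply/eqP; move: x.
apply: (@linear_malg0 F K F^o) => [a x y|j].
  by rewrite linext_linear mcoeffD mcoeffZ scalerBr opprD addrACA.
by rewrite linextU mcoeffU subrr.
Qed.

Lemma mhv_coord_eq0 (F : numFieldType) (x : MHV F) :
  (forall i, linext (fun j => (j == i)%:R : F^o) x = 0) -> x = 0.
Proof. by move=> x0; apply/malgP => i; rewrite -linext_delta x0 mcoeff0. Qed.

Theorem corollary1p2 (R : realType) (delta : R[i]) :
  [/\ delta = 1 ->
        is_direct_sum (Der (MHV R[i]) delta) (Inn (MHV R[i])) (line mhv_tau),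
      delta = 2^-1 -> Der (MHV R[i]) delta = line id
    & delta != 1 -> delta != 2^-1 -> Der (MHV R[i]) delta = [set 0]].
Proof.
pose ext := fun W : lmodType R[i] => @linext R[i] mhv_index W.
have ext_linear W u : linear (ext W u) by exact: linext_linear.
have ext_e W u i : ext W u (mhv_basis i) = u i by exact: linextU.
have lin0 := @mhv_linear0 R[i].
have coord0 := @mhv_coord_eq0 R[i].
have lieE := @mhv_lie_basis R[i].
split=> [->|->|d1 d2].
- exact: (@Der1_direct_sum _ (MHV R[i]) _ ext).
- exact: (@Der_half _ (MHV R[i]) mhv_basis ext).
- exact: (@Der_other _ (MHV R[i]) mhv_basis ext).
Qed.
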